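(* Let $T$ be a tree rooted at $o$, let $X$ be either $\mathcal{L}_{\mathbf{w}}$ or $\mathcal{L}_{\mathbf{w},0}$, and let $\psi:T\to\mathbb{C}$ be such that $M_\psi$ is a bounded multiplication operator on $X$. Then the operator norm of $M_\psi$ on $X$ satisfies $$\max\{\|\psi\|_{\mathbf{w}},\|\psi\|_\infty\}\le \|M_\psi\|\le \|\psi\|_\infty+\sup_{v\in T^*}|v|(1+\log|v|)D\psi(v).$$
   Context: A tree $T$ is a locally finite, connected, simply-connected graph, identified with its set of vertices; $T$ is assumed to have no terminal vertices (vertices with exactly one neighbor), so it is infinite, and it is rooted at a vertex $o$. $|v|$ is the number of edges in the unique path from $o$ to $v$; $T^*=T\setminus\{o\}$; for $v\in T^*$, $v^-$ is the neighbor of $v$ closest to $o$. For $f:T\to\mathbb{C}$ and $v\in T^*$, $Df(v)=|f(v)-f(v^-)|$. The weighted Lipschitz space $\mathcal{L}_{\mathbf{w}}$ is the set of $f:T\to\mathbb{C}$ with $\sup_{v\in T^*}|v|Df(v)<\infty$, normed by $\|f\|_{\mathbf{w}}=|f(o)|+\sup_{v\in T^*}|v|Df(v)$ (a Banach space). The little weighted Lipschitz space $\mathcal{L}_{\mathbf{w},0}$ is the closed subspace of those $f\in\mathcal{L}_{\mathbf{w}}$ with $\lim_{|v|\to\infty}|v|Df(v)=0$. $\|f\|_\infty=\sup_{v\in T}|f(v)|$. $M_\psi f=\psi f$ (pointwise product); ''$M_\psi$ is bounded on $X$'' means $M_\psi$ maps $X$ into $X$ and is a bounded linear operator there. *)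

(* Defs.v *)
From mathcomp Require Import all_boot all_order all_algebra.
From mathcomp Require Import all_classical all_reals all_analysis.
From mathcomp Require Export complex.
Set Implicit Arguments.
Unset Strict Implicit.
Unset Printing Implicit Defensive.
Import Order.TTheory GRing.Theory Num.Theory.
Import numFieldNormedType.Exports.
Local Open Scope classical_set_scope.
Local Open Scope ring_scope.

(* [tree_infinite] only excludes the one-vertex graph, which has no vertex with
   exactly one neighbor. *)
Record tree := Tree {
  vertex :> choiceType;
  adj : rel vertex;
  adj_sym : symmetric adj;
  adj_irr : irreflexive adj;
  tree_locally_finite : forall x, finite_set [set y | adj x y];
  tree_connected : forall x y, exists p, path adj x p /\ last x p = y;
  tree_acyclic : forall c, ucycle adj c -> (size c <= 2)%N;
  tree_no_terminal : forall x, ~ exists y, [set z | adj x z] = [set y];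
  tree_infinite : infinite_set [set: vertex]
}.

Section RootedTree.
Context {T : tree} (o : T).

(* As in [path], the starting vertex [x] is not listed in [p]. *)
Definition simple_path (x y : T) (p : seq T) : Prop :=
  [/\ path (@adj T) x p, uniq (x :: p) & last x p = y].

Definition level (v : T) : nat := size (xget [::] (simple_path o v)).

(* Only meaningful for [v != o]. *)
Definition parent (v : T) : T :=
  xget v [set u | adj v u /\ forall w, adj v w -> (level u <= level w)%N].

Definition level_infty : set_system T :=
  filter_from [set: nat] (fun N => [set v | (N <= level v)%N]).

Global Instance level_infty_filter : Filter level_infty.
Proof.
apply: filter_fromT_filter; first by exists 0%N.
move=> i j; exists (maxn i j) => v /=.
by rewrite geq_max => /andP[].
Qed.

End RootedTree.

Section WeightedLipschitz.
Context {R : realType} {T : tree} (o : T).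
Implicit Types (f psi : T -> R[i]) (X : set (T -> R[i])).

Definition modulus (z : R[i]) : R := ComplexField.Normc.normc z.

Definition Dlip f (v : T) : R := modulus (f v - f (parent o v)).

Definition wlip_seminorm f : \bar R :=
  ereal_sup [set ((level o v)%:R * Dlip f v)%:E | v in [set v | v != o]].

Definition wlip_norm f : \bar R := ((modulus (f o))%:E + wlip_seminorm f)%E.

Definition wlip : set (T -> R[i]) := [set f | (wlip_seminorm f < +oo)%E].

Definition little_wlip : set (T -> R[i]) :=
  [set f | wlip f /\
    (level o v)%:R * Dlip f v @[v --> level_infty o] --> (0 : R)].

Definition sup_norm f : \bar R := ereal_sup [set (modulus (f v))%:E | v in [set: T]].

Definition log_wlip_seminorm f : \bar R :=
  ereal_sup [set ((level o v)%:R * (1 + ln (level o v)%:R) * Dlip f v)%:E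
            | v in [set v | v != o]].

Definition mult_op psi : (T -> R[i]) -> (T -> R[i]) := fun f => psi \* f.

Definition bounded_operator_on X (M : (T -> R[i]) -> (T -> R[i])) : Prop :=
  [/\ forall f, X f -> X (M f),
      forall (a : R[i]) f g, X f -> X g ->
        M (fun v => a * f v + g v) = (fun v => a * M f v + M g v)
    & exists C : R, forall f, X f -> (wlip_norm (M f) <= C%:E * wlip_norm f)%E].

Definition operator_norm X (M : (T -> R[i]) -> (T -> R[i])) : \bar R :=
  ereal_sup [set wlip_norm (M f) | f in [set f | X f /\ (wlip_norm f <= 1)%E]].

End WeightedLipschitz.

(* Main.v *)
Require Import Defs.
From mathcomp Require Import all_boot all_order all_algebra.
From mathcomp Require Import all_classical all_reals all_analysis.
From mathcomp Require Import ring lra.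

(** Lower bound: the constant function 1 has norm 1 and is mapped to [psi], and
    the indicator of a vertex [v] is an eigenvector for the eigenvalue [psi v];
    both lie in the little space. Upper bound: summing the increments of [f]
    along the path from [o] to [v] and comparing the harmonic sum with the
    logarithm gives [|f v| <= |f o| + s (1 + log |v|)], where [s] bounds
    [|w| Df(w)]; insert this in
    [D(psi f) v <= Dpsi(v) |f v| + |psi(v^-)| Df(v)]. *)

Set Implicit Arguments.
Unset Strict Implicit.
Unset Printing Implicit Defensive.
Import Order.TTheory GRing.Theory Num.Theory.
Import numFieldNormedType.Exports.
Local Open Scope classical_set_scope.
Local Open Scope ring_scope.

(** * Simple paths, levels and parents in the rooted tree *)

Section TreeGeometry.
Context {T : tree}.
Implicit Types (x y : T) (p q : seq T).

(** Loop erasure. The inclusion ensures that the shortened path still avoids every vertex that [p]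
    avoids. *)
Lemma walk_simple_path x p :
  path (@adj T) x p ->
  exists2 q, simple_path x (last x p) q & {subset q <= p}.
Proof. by case/shortenP => q eq uq qp; exists q => //; split. Qed.

Lemma simple_path_exists x y : exists p, simple_path x y p.
Proof.
have [p [+ <-]] := tree_connected x y.
by case/walk_simple_path => q; exists q.
Qed.

(* If the two paths leave [x] through distinct neighbors [a] and [b], then
   joining them at [y] gives a walk from [a] to [b] avoiding [x], hence a cycle
   through [x]. *)
Lemma simple_path_unique x y p q :
  simple_path x y p -> simple_path x y q -> p = q.
Proof.
elim: p q x => [|a p IH] [|b q] x //.
- by case=> _ _ <- [_ /= /andP[+ _] yx]; rewrite -{1}yx mem_last.
- by move=> [_ /= /andP[+ _] yx] [_ _ /= xy]; rewrite xy -{1}yx mem_last.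
move=> [/= /andP[xa pp] /andP[xp up] lp] [/= /andP[xb pq] /andP[xq uq] lq].
have [ab|ab] := eqVneq a b.
  by move: lq pq uq; rewrite -ab => lq pq uq; congr cons; exact: (IH _ a).
(* The final [y] of [b :: q] is dropped, since [a :: p] already ends there. *)
pose w := p ++ rev (belast b q).
have pw : path (@adj T) a w.
  rewrite cat_path pp lp -lq rev_path.
  by rewrite (eq_path (e' := @adj T)) // => u v; rewrite adj_sym.
have lw : last a w = b.
  rewrite last_cat lp; case: q lq {pq uq xq pw w IH} => [//|c q _] /=.
  by rewrite rev_cons last_rcons.
have xw : x \notin a :: w.
  rewrite -cat_cons mem_cat negb_or xp mem_rev.
  by apply: contra xq => /mem_belast.
have [r [pr ur lr] rw] := walk_simple_path pw.
have xr : x \notin a :: r.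
  apply: contra xw; rewrite !inE => /orP[->//|/rw ->]; exact: orbT.
have : ucycle (@adj T) (x :: a :: r).
  by rewrite /ucycle /= rcons_path xa pr lr lw (adj_sym b x) xb /= xr.
(* Acyclicity allows at most two vertices here, so [r] is empty and [a = b]. *)
move=> /tree_acyclic; case: r {pr ur xr rw} lr => [/= ba _|//].
by move: ab; rewrite ba lw eqxx.
Qed.

Variable o : T.

(** Uniqueness frees [level] from the choice made by [xget]. *)
Lemma level_simple_path x p : simple_path o x p -> level o x = size p.
Proof.
move=> xp; rewrite /level; congr size; apply: simple_path_unique xp.
exact: xgetPex (simple_path_exists o x).
Qed.

Lemma level_root : level o o = 0%N.
Proof. exact: (@level_simple_path o [::]). Qed.

(** Cut a simple path from [o] to [y] at [x] if it meets [x]; otherwise extend it by [x]. *)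
Lemma level_adj x y : x != o -> adj x y -> (level o x <= (level o y).+1)%N.
Proof.
move=> xo xy; have [p yp] := simple_path_exists o y.
rewrite (level_simple_path yp); case: yp => pp /= /andP[op up] lp.
have [xp|xp] := boolP (x \in p).
  case/splitPr: xp pp op up {lp} => p1 p2.
  rewrite -cat_rcons cat_path mem_cat negb_or cat_uniq.
  move=> /andP[pp _] /andP[op _] /andP[up _].
  rewrite (@level_simple_path x (rcons p1 x)) ?size_cat ?leqW ?leq_addr //.
  by split=> //=; rewrite ?op ?last_rcons.
rewrite (@level_simple_path x (rcons p x)) ?size_rcons //.
split; rewrite ?last_rcons ?rcons_path ?pp ?lp ?(adj_sym y) //=.
by rewrite mem_rcons inE eq_sym (negPf xo) op rcons_uniq xp.
Qed.

(** The predecessor of [x] on its simple path from [o] lies one level lower, and by [level_adj] no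
    neighbor lies lower still; so the minimum in [parent] exists and is attained at that level. *)
Lemma level_parent x : x != o -> level o x = (level o (parent o x)).+1.
Proof.
move=> xo; have [p xp] := simple_path_exists o x.
have [u [xu lu]] : exists u, adj x u /\ level o x = (level o u).+1.
  rewrite (level_simple_path xp); case: xp xo.
  case/lastP: p => [_ _ /= -> /eqP//|p z pp up].
  rewrite last_rcons => zx _; rewrite -{}zx; exists (last o p).
  move: pp; rewrite rcons_path => /andP[pp pz]; rewrite adj_sym; split=> //.
  rewrite size_rcons (@level_simple_path _ p) //; split=> //.
  by move: up; rewrite -rcons_cons rcons_uniq => /andP[].
have [xt mt] : [set u | adj x u /\
    forall w, adj x w -> (level o u <= level o w)%N] (parent o x).
  rewrite /parent; apply: (xgetPex x); exists u; split=> // w xw.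
  by rewrite -ltnS -lu; exact: level_adj.
by apply/eqP; rewrite eqn_leq level_adj //= lu ltnS mt.
Qed.

Lemma level_gt0 x : x != o -> (0 < level o x)%N.
Proof. by move=> /level_parent ->. Qed.

(** Keeps the suprema over [v != o] from being empty, hence from being [-oo]. *)
Lemma exists_neq_root : exists x, x != o.
Proof.
apply: contrapT => no; apply: (@tree_infinite T).
apply: (@sub_finite_set _ _ [set o]); last exact: finite_set1.
by move=> x _ /=; apply: contrapT => /eqP xo; apply: no; exists x.
Qed.

End TreeGeometry.

(** * Modulus, increments and the weighted norm *)

Section WeightedLipschitzNorm.
Context {R : realType} {T : tree} (o : T).
Implicit Types (f g psi : T -> R[i]) (X : set (T -> R[i])) (v w : T).

Lemma modulus_ge0 (z : R[i]) : 0 <= modulus z.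
Proof. by case: z => a b; rewrite sqrtr_ge0. Qed.

Lemma modulus0 : modulus (0 : R[i]) = 0.
Proof. exact: ComplexField.Normc.normc0. Qed.

Lemma modulus1 : modulus (1 : R[i]) = 1.
Proof. exact: ComplexField.Normc.normc1. Qed.

Lemma modulusM (y z : R[i]) : modulus (y * z) = modulus y * modulus z.
Proof. exact: ComplexField.Normc.normcM. Qed.

Lemma modulusN (z : R[i]) : modulus (- z) = modulus z.
Proof. exact: normcN. Qed.

Lemma modulusD (y z : R[i]) : modulus (y + z) <= modulus y + modulus z.
Proof. exact: le_normcD. Qed.

Lemma modulus_real (a : R) : 0 <= a -> modulus (a%:C)%C = a.
Proof. by move=> a0; rewrite /modulus /= expr0n /= addr0 sqrtr_sqr ger0_norm. Qed.

Lemma Dlip_ge0 f v : 0 <= Dlip o f v.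
Proof. exact: modulus_ge0. Qed.

Lemma DlipZ (a : R[i]) f v :
  Dlip o (fun w => a * f w) v = modulus a * Dlip o f v.
Proof. by rewrite /Dlip -mulrBr modulusM. Qed.

Lemma Dlip_le f v B : (forall w, modulus (f w) <= B) -> Dlip o f v <= B + B.
Proof.
move=> fB; apply: le_trans (modulusD _ _) _.
by rewrite modulusN lerD.
Qed.

Lemma le_modulus_parent f v : modulus (f v) <= modulus (f (parent o v)) + Dlip o f v.
Proof. by rewrite addrC -{1}(subrK (f (parent o v)) (f v)) modulusD. Qed.

(** With [u] the parent of [v], split [psi v * f v - psi u * f u] as [(psi v - psi u) * f v + psi u
    * (f v - f u)]. *)
Lemma Dlip_mul psi f v :
  Dlip o (psi \* f) v <=
    Dlip o psi v * modulus (f v) + modulus (psi (parent o v)) * Dlip o f v.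
Proof.
rewrite /Dlip /= -!modulusM; apply: le_trans _ (modulusD _ _).
by rewrite le_eqVlt; apply/orP/or_introl/eqP; congr modulus; ring.
Qed.

Lemma wlip_norm_le f (C : R) :
  (forall v, v != o -> modulus (f o) + (level o v)%:R * Dlip o f v <= C) ->
  (wlip_norm o f <= C%:E)%E.
Proof.
move=> fC; rewrite /wlip_norm -leeBrDl //; apply: ge_ereal_sup.
by move=> _ [v vo <-]; rewrite -EFinB lee_fin lerBrDl fC.
Qed.

Lemma wlip_norm_ge f v :
  v != o -> ((modulus (f o) + (level o v)%:R * Dlip o f v)%:E <= wlip_norm o f)%E.
Proof.
move=> vo; rewrite EFinD leeD2lE //; apply: ereal_sup_ubound.
by exists v.
Qed.

Lemma wlip_norm_ge_root f : ((modulus (f o))%:E <= wlip_norm o f)%E.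
Proof.
have [v vo] := exists_neq_root o; apply: le_trans (wlip_norm_ge f vo).
by rewrite lee_fin lerDl mulr_ge0 // Dlip_ge0.
Qed.

Lemma wlip_normZ (a : R[i]) f :
  (wlip_norm o (fun v => a * f v)%R = (modulus a)%:E * wlip_norm o f)%E.
Proof.
rewrite /wlip_norm modulusM ge0_muleDr ?lee_fin ?modulus_ge0 //; last first.
  (* Distributivity in the extended reals needs a nonnegative seminorm; one term of the supremum
     shows it. *)
  have [v vo] := exists_neq_root o.
  apply: (@le_trans _ _ ((level o v)%:R * Dlip o f v)%:E).
    by rewrite lee_fin mulr_ge0 // Dlip_ge0.
  by apply: ereal_sup_ubound; exists v.
congr (_ + _)%E; rewrite -ereal_supZl ?modulus_ge0 //; last first.
  have [v vo] := exists_neq_root o.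
  by apply/set0P; exists ((level o v)%:R * Dlip o f v)%:E; exists v.
congr ereal_sup; rewrite image_comp; apply: eq_imagel => v _ /=.
by rewrite DlipZ -EFinM mulrCA.
Qed.

Lemma wlip_norm_lty f : wlip o f -> (wlip_norm o f < +oo)%E.
Proof. by move=> fo; rewrite /wlip_norm lte_add_pinfty ?ltry. Qed.

(** * Test functions in the little space *)

Lemma little_wlip_bounded f (n : nat) (B : R) :
  (forall v, modulus (f v) <= B) ->
  (forall v, (n < level o v)%N -> Dlip o f v = 0) ->
  little_wlip o f.
Proof.
move=> fB fn; split; last first.
  apply: (@cvg_trans _ ((fun=> (0 : R)) @ level_infty o)); last exact: cvg_cst.
  apply: near_eq_cvg; exists n.+1 => // v /= nv.
  by rewrite fn ?mulr0.
apply: (@le_lt_trans _ _ (n%:R * (B + B))%:E); last exact: ltry.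
have B0 : 0 <= B := le_trans (modulus_ge0 _) (fB o).
apply: ge_ereal_sup => _ [v vo <-]; rewrite lee_fin.
have [vn|nv] := leqP (level o v) n.
  by rewrite ler_pM ?Dlip_ge0 ?ler_nat // Dlip_le.
by rewrite fn // mulr0 mulr_ge0 // addr_ge0.
Qed.

Definition indicator v : T -> R[i] := fun w => if w == v then 1 else 0.

(** Away from [o], nonzero increments occur only at [v] and its children, hence up to level
    [(level o v).+1]. *)
Lemma little_wlip_indicator (a : R[i]) v :
  little_wlip o (fun w => a * indicator v w).
Proof.
apply: (@little_wlip_bounded _ (level o v).+1 (modulus a)) => w.
  rewrite /indicator; case: ifP => _; rewrite ?mulr1 // mulr0 modulus0.
  exact: modulus_ge0.
move=> vw; have wo : w != o by apply: contraTneq vw => ->; rewrite level_root.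
move: vw; rewrite (level_parent wo) ltnS => vw.
rewrite /Dlip /indicator ifF; last first.
  by apply: contraTF vw => /eqP <-; rewrite (level_parent wo) -leqNgt.
rewrite ifF ?subrr ?modulus0 //.
by apply: contraTF vw => /eqP <-; rewrite ltnn.
Qed.

(** Positivity comes from the value at [v] when [v] is the root, and otherwise from the jump between
    [v] and its parent. *)
Lemma wlip_norm_indicator_gt0 v : (0 < wlip_norm o (indicator v))%E.
Proof.
have [->|vo] := eqVneq v o.
  apply: lt_le_trans (wlip_norm_ge_root _).
  by rewrite /indicator eqxx modulus1 lte_fin.
apply: lt_le_trans (wlip_norm_ge _ vo).
rewrite lte_fin ltr_wpDl ?modulus_ge0 // mulr_gt0 ?ltr0n ?level_gt0 //.
rewrite /Dlip /indicator eqxx ifF ?subr0 ?modulus1 //.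
apply/eqP => pv; have := level_parent vo.
by rewrite pv => /eqP; rewrite -{1}[level o v]addn0 -addn1 eqn_add2l.
Qed.

(** * Lower bounds for the operator norm *)

Lemma operator_norm_ge X M f :
  X f -> (wlip_norm o f <= 1)%E ->
  (wlip_norm o (M f) <= operator_norm o X M)%E.
Proof. by move=> Xf f1; apply: ereal_sup_ubound; exists f. Qed.

(* The indicator of [v] is an eigenvector of [M_psi] for the eigenvalue
   [psi v]. *)
Lemma modulus_le_operator_norm X psi v :
  little_wlip o `<=` X ->
  ((modulus (psi v))%:E <= operator_norm o X (mult_op psi))%E.
Proof.
move=> lX; pose N := wlip_norm o (indicator v).
have N0 : (0 < N)%E := wlip_norm_indicator_gt0 v.
have Nfin : N \is a fin_num.
  rewrite gt0_fin_numE //; apply: wlip_norm_lty.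
  have [+ _] := little_wlip_indicator 1 v.
  by congr (wlip o _); apply/funext => w; rewrite mul1r.
have r0 : 0 < fine N by rewrite fine_gt0 // N0 ltey_eq Nfin.
(* Scaling by the inverse of its norm gives the indicator norm 1. *)
pose a := ((fine N)^-1%:C)%C; pose f w := a * indicator v w.
have f1 : wlip_norm o f = 1%E.
  rewrite wlip_normZ -/N -(fineK Nfin) modulus_real ?invr_ge0 ?ltW //.
  by rewrite -EFinM mulVf // gt_eqF.
have -> : ((modulus (psi v))%:E = wlip_norm o (mult_op psi f))%E.
  have -> : mult_op psi f = fun w => psi v * f w.
    apply/funext => w; rewrite /mult_op /f /indicator /=.
    by case: eqP => [->//|_]; rewrite !mulr0.
  by rewrite wlip_normZ f1 mule1.
by apply: operator_norm_ge; [exact/lX/little_wlip_indicator|rewrite f1].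
Qed.

Lemma wlip_norm_le_operator_norm X psi :
  little_wlip o `<=` X ->
  (wlip_norm o psi <= operator_norm o X (mult_op psi))%E.
Proof.
move=> lX; have D1 v : Dlip o (fun=> 1) v = 0 :> R.
  by rewrite /Dlip subrr modulus0.
have -> : wlip_norm o psi = wlip_norm o (mult_op psi (fun=> 1)).
  by congr wlip_norm; apply/funext => v; rewrite /mult_op /= mulr1.
apply: operator_norm_ge.
  apply: lX; apply: (@little_wlip_bounded _ 0 1) => v; last by rewrite D1.
  by rewrite modulus1.
by apply: wlip_norm_le => v _; rewrite D1 mulr0 addr0 modulus1.
Qed.

(** * Logarithmic growth and the upper bound *)

Lemma invSn_le_ln (n : nat) :
  (0 < n)%N -> n.+1%:R^-1 <= ln n.+1%:R - ln n%:R :> R.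
Proof.
move=> n0; have n0R : 0 < n%:R :> R by rewrite ltr0n.
have n1R : 0 < n.+1%:R :> R by rewrite ltr0n.
have e : n%:R / n.+1%:R = 1 + - n.+1%:R^-1 :> R.
  by rewrite -{1}[n%:R](addrK 1) -natr1 mulrBl divff ?gt_eqF // mul1r.
(* Use [ln (1 + x) <= x] at [x = - 1 / (n + 1)], where [1 + x = n / (n + 1)]. *)
have := @le_ln1Dx R (- n.+1%:R^-1).
rewrite -e ln_div ?posrE // lerNr opprB; apply.
by rewrite ltrN2 invf_lt1 // ltr1n.
Qed.

Lemma modulus_le_log f (s : R) v :
  (forall w, w != o -> (level o w)%:R * Dlip o f w <= s) ->
  v != o -> modulus (f v) <= modulus (f o) + s * (1 + ln (level o v)%:R).
Proof.
move=> fs; have s0 : 0 <= s.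
  have [w wo] := exists_neq_root o; apply: le_trans (fs w wo).
  by rewrite mulr_ge0 // Dlip_ge0.
(* Induction on the level, with the vertex left free so as to pass to its parent. *)
move: {2}(level o v) (erefl (level o v)) => n.
elim: n v => [|n IH] v vn vo; first by have := level_gt0 vo; rewrite vn.
have Dv : Dlip o f v <= s / n.+1%:R.
  by rewrite ler_pdivlMr ?ltr0n // mulrC -vn fs.
apply: le_trans (le_modulus_parent f v) _.
have /eqP := level_parent vo; rewrite vn eqSS eq_sym => /eqP pn.
(* Children of the root start the sum: there [ln 1 = 0], and the increment is at most [s]. *)
have [po|po] := eqVneq (parent o v) o.
  move: pn Dv; rewrite po level_root => <-; rewrite ln1 addr0 mulr1 divr1.
  by rewrite lerD2l.
have n0 : (0 < n)%N by rewrite -pn level_gt0.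
have := IH _ pn po; rewrite pn => Ip.
have := ler_wpM2l s0 (invSn_le_ln n0).
move: Dv; move: (_^-1) (ln n.+1%:R) => c L' Dv; nra.
Qed.

Lemma wlip_norm_mul_le psi f (r l : R) :
  (wlip_norm o f <= 1)%E ->
  (forall v, modulus (psi v) <= r) ->
  (forall v, v != o ->
    (level o v)%:R * (1 + ln (level o v)%:R) * Dlip o psi v <= l) ->
  (wlip_norm o (mult_op psi f) <= (r + l)%:E)%E.
Proof.
(* Taking for [s] what [f o] leaves of the unit norm, rather than 1, makes the bounds [r * s] and
   [r * modulus (f o)] below add up to exactly [r]. *)
move=> f1 psir psil; pose s := 1 - modulus (f o).
have fs w : w != o -> (level o w)%:R * Dlip o f w <= s.
  move=> wo; have := le_trans (wlip_norm_ge f wo) f1.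
  by rewrite lee_fin /s lerBrDl.
have fo1 : modulus (f o) <= 1.
  by have := le_trans (wlip_norm_ge_root f) f1; rewrite lee_fin.
have fo0 := modulus_ge0 (f o).
apply: wlip_norm_le => v vo /=; rewrite modulusM.
have := psil v vo; have := fs v vo; have := modulus_le_log fs vo.
have := Dlip_mul psi f v; have := psir o; have := psir (parent o v).
have := modulus_ge0 (psi (parent o v)); have := modulus_ge0 (psi o).
have := Dlip_ge0 f v; have := Dlip_ge0 psi v.
have : 1 <= (level o v)%:R :> R by rewrite ler1n level_gt0.
have : 0 <= ln (level o v)%:R :> R by rewrite ln_ge0 // ler1n level_gt0.
move: (level o v)%:R (ln _) => n L L0 n1 Dp0 Df0 po0 pp0 ppr por Dm fv Df Dl.
(* By the choice of [s], the logarithmic bound equals [1 + s * L], and [s <= 1]. *)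
have fv' : modulus (f v) <= 1 + L.
  by apply: le_trans fv _; rewrite /s; nra.
have h1 : n * (Dlip o psi v * modulus (f v)) <= l.
  apply: le_trans Dl; rewrite mulrAC -mulrA ler_wpM2l //; first by lra.
  by rewrite ler_wpM2l.
have h2 : n * (modulus (psi (parent o v)) * Dlip o f v) <= r * s.
  by rewrite mulrCA ler_pM // mulr_ge0 //; lra.
have h3 : modulus (psi o) * modulus (f o) <= r * modulus (f o).
  by rewrite ler_wpM2r.
have h4 := ler_wpM2l (le_trans ler01 n1) Dm.
by rewrite /s in h2; lra.
Qed.

End WeightedLipschitzNorm.

Theorem theorem5p1 (R : realType) (T : tree) (o : T) (X : set (T -> R[i]))
    (psi : T -> R[i])
    (hX : X = wlip o \/ X = little_wlip o)
    (hpsi : bounded_operator_on o X (mult_op psi)) :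
  (Order.max (wlip_norm o psi) (sup_norm psi)
     <= operator_norm o X (mult_op psi))%E /\
  (operator_norm o X (mult_op psi)
     <= sup_norm psi + log_wlip_seminorm o psi)%E.
Proof.
(* Both choices of [X] contain the little space, hence the test functions. *)
have lX : little_wlip o `<=` X by case: hX => -> // f [].
split.
  rewrite ge_max wlip_norm_le_operator_norm //=.
  by apply: ge_ereal_sup => _ [v _ <-]; exact: modulus_le_operator_norm.
have ubS v : ((modulus (psi v))%:E <= sup_norm psi)%E.
  by apply: ereal_sup_ubound; exists v.
have ubL v : v != o -> (((level o v)%:R * (1 + ln (level o v)%:R) * Dlip o psi v)%:E
    <= log_wlip_seminorm o psi)%E.
  by move=> vo; apply: ereal_sup_ubound; exists v.
(* The terms at [o] and at [w] exclude [-oo] for the two suprema; if either is [+oo] the bound is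
   trivial, so both may be taken real. *)
have [w wo] := exists_neq_root o.
have := ubL w wo; have := ubS o.
case eS : (sup_norm psi) ubS => [r| |] ubS // _;
  case eL : (log_wlip_seminorm o psi) ubL => [l| |] ubL // _;
  rewrite ?leey //.
apply: ge_ereal_sup => _ [f [_ f1] <-]; exact: wlip_norm_mul_le.
Qed.
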